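(* Let $A$ be a simple Artinian ring and let $(P,R)$ be an invariant prime of $A$ with $P\neq 0$, where $R$ is a Goldie ring. For $I\in\mathcal{F}(R)$ let $v(I)=\{a\in A\mid aI\subseteq P\}$ and let $\Gamma=\{v(I)\mid I\in\mathcal{F}(R)\}$, with the operation $v(I)+v(J)=v(IJ)$ and the order $v(I)\leq v(J)\Leftrightarrow v(I)\subseteq v(J)$. If $\Gamma$ is an Archimedean group, then $R$ is a valuation ring.
   Context: A prime in a ring $A$ is a pair $(P,R)$ where $R$ is a subring of $A$ and $P\subset R$ is a prime ideal of $R$ such that for all $x,y\in A$, $xRy\subseteq P$ implies $x\in P$ or $y\in P$. It is strict fractional if for every $r\neq 0$ in $A$ there are $x,y\in R$ with $0\neq xry\in R$. Put $A^{P}=\{a\in A\mid aP\subseteq P\text{ and }Pa\subseteq P\}$. A ring is Goldie if its set $S$ of regular elements satisfies the Ore condition and the localization $S^{-1}R$ is semisimple Artinian. An invariant prime of a simple Artinian ring $A$ is a strict fractional prime $(P,R)$ of $A$ with $R=A^{P}$, $R$ Goldie (so that $R$ is a prime ring and an order in $A$), and $P$ invariant under all inner automorphisms of $A$ (i.e. $uPu^{-1}\subseteq P$ for all units $u$ of $A$). A fractional $R$-ideal of $A$ is an $R$-bimodule $I\subseteq A$ which contains a regular element of $R$ and satisfies $rI\subseteq R$ for some regular $r\in R$; $\mathcal{F}(R)$ is the set of fractional $R$-ideals. The operation $+$ on $\Gamma$ is well defined with neutral element $v(R)=P$, and $\Gamma$ is totally ordered by $\leq$. A totally ordered group is Archimedean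 if for all $\alpha,\beta>0$ there is a positive integer $n$ with $n\alpha>\beta$. That $R$ is a valuation ring means: $A$ is a skewfield, $R$ is invariant under inner automorphisms of $A$, and for every nonzero $a\in A$ one has $a\in R$ or $a^{-1}\in R$. *)

(* Defs.v *)
From HB Require Import structures.
From mathcomp Require Import all_boot all_order all_algebra.
From mathcomp Require Import boolp classical_sets.

Set Implicit Arguments.
Unset Strict Implicit.
Unset Printing Implicit Defensive.

Import GRing.Theory.

Local Open Scope classical_set_scope.
Local Open Scope ring_scope.

(* The ring structure of a subring; [subringClosed A] is the library's type of
   predicates on [A] that contain 1 and are closed under [-] and [*]. *)
Definition subring (A : nzRingType) (R : subringClosed A) : Type :=
  {x : A | x \in R}.

HB.instance Definition _ (A : nzRingType) (R : subringClosed A) :=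
  SubChoice.on (subring R).
HB.instance Definition _ (A : nzRingType) (R : subringClosed A) :=
  [SubChoice_isSubNzRing of subring R by <:].

Definition subring_set (A : nzRingType) (R : subringClosed A) : set A :=
  [set x | x \in R].

Section Rings.
Variable T : nzRingType.

Definition additive_subgroup (I : set T) : Prop :=
  I 0 /\ forall x y, I x -> I y -> I (x - y).

Definition left_ideal (I : set T) : Prop :=
  additive_subgroup I /\ forall r x, I x -> I (r * x).

Definition right_ideal (I : set T) : Prop :=
  additive_subgroup I /\ forall r x, I x -> I (x * r).

Definition two_sided_ideal (I : set T) : Prop :=
  left_ideal I /\ right_ideal I.

Definition dcc (K : set (set T)) : Prop :=
  forall I : nat -> set T,
    (forall n, K (I n)) -> (forall n, I n.+1 `<=` I n) ->
    exists N, forall n, (N <= n)%N -> I n = I N.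

Definition artinian : Prop := dcc left_ideal /\ dcc right_ideal.

Definition simple_ring : Prop :=
  forall I : set T, two_sided_ideal I -> I = [set 0] \/ I = setT.

Definition maximal_left_ideal (M : set T) : Prop :=
  [/\ left_ideal M, M <> setT &
      forall I : set T, left_ideal I -> M `<=` I -> I = M \/ I = setT].

Definition jacobson_radical : set T :=
  [set x | forall M, maximal_left_ideal M -> M x].

Definition semisimple_artinian : Prop :=
  artinian /\ jacobson_radical = [set 0].

End Rings.

Section Goldie.
Variable T : nzRingType.

Definition prime_ideal (P : set T) : Prop :=
  [/\ two_sided_ideal P, P <> setT &
      forall I J : set T, two_sided_ideal I -> two_sided_ideal J ->
        (forall x y, I x -> J y -> P (x * y)) -> I `<=` P \/ J `<=` P].

Definition regular (s : T) : Prop := GRing.lreg s /\ GRing.rreg s.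

Definition left_ore : Prop :=
  forall r s : T, regular s ->
    exists r' s' : T, regular s' /\ s' * r = r' * s.

Definition right_ore : Prop :=
  forall r s : T, regular s ->
    exists r' s' : T, regular s' /\ r * s' = s * r'.

(* [Q], with the map [f], is the localization of [T] at its regular elements.
   Elements killed by a regular element vanish, whence the injectivity. *)
Definition is_localization (Q : unitRingType) (f : {rmorphism T -> Q}) : Prop :=
  [/\ injective f, forall s, regular s -> f s \is a GRing.unit &
      forall q, exists s r, regular s /\ q = (f s)^-1 * f r].

Definition goldie : Prop :=
  [/\ left_ore, right_ore &
      exists (Q : unitRingType) (f : {rmorphism T -> Q}),
        is_localization f /\ semisimple_artinian Q].

End Goldie.

Section Primes.
Variables (A : unitRingType) (P : set A) (R : subringClosed A).

Definition prime_in : Prop :=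
  [/\ P `<=` subring_set R,
      prime_ideal [set x : subring R | P (val x)] &
      forall x y : A, (forall r, r \in R -> P (x * r * y)) -> P x \/ P y].

Definition strict_fractional : Prop :=
  forall r : A, r != 0 ->
    exists x y, [/\ x \in R, y \in R, x * r * y != 0 & x * r * y \in R].

Definition idealizer : set A :=
  [set a | (forall p, P p -> P (a * p)) /\ (forall p, P p -> P (p * a))].

Definition inner_invariant (X : set A) : Prop :=
  forall u x : A, u \is a GRing.unit -> X x -> X (u * x * u^-1).

Definition invariant_prime : Prop :=
  [/\ prime_in, strict_fractional, subring_set R = idealizer,
      goldie (subring R) & inner_invariant P].

Definition fractional_ideal (I : set A) : Prop :=
  [/\ additive_subgroup I,
      forall r x, r \in R -> I x -> I (r * x) /\ I (x * r),
      exists s : subring R, regular s /\ I (val s) &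
      exists r : subring R, regular r /\ forall x, I x -> val r * x \in R].

Definition ideal_mul (I J : set A) : set A :=
  [set a | exists s : seq (A * A),
     (forall z, z \in s -> I z.1 /\ J z.2) /\ a = \sum_(z <- s) z.1 * z.2].

Definition v (I : set A) : set A :=
  [set a | forall x, I x -> P (a * x)].

Definition Gamma : set (set A) :=
  [set alpha | exists2 I, fractional_ideal I & alpha = v I].

(* The value [v (ideal_mul I J)] for any [I], [J] representing [alpha],
   [beta]; for an invariant prime it does not depend on the representatives.
   Outside [Gamma] the operation is irrelevant. *)
Definition Gamma_add (alpha beta : set A) : set A :=
  get [set gamma | exists I J,
    [/\ fractional_ideal I, fractional_ideal J, alpha = v I, beta = v J &
        gamma = v (ideal_mul I J)]].

Definition Gamma_zero : set A := v (subring_set R).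

Definition valuation_ring : Prop :=
  [/\ forall a : A, a != 0 -> a \is a GRing.unit,
      inner_invariant (subring_set R) &
      forall a : A, a != 0 -> a \in R \/ a^-1 \in R].

End Primes.

Definition group_on (X : Type) (G : set X) (add : X -> X -> X) (zero : X) :
    Prop :=
  [/\ G zero,
      forall a b, G a -> G b -> G (add a b),
      forall a b c, G a -> G b -> G c -> add a (add b c) = add (add a b) c,
      forall a, G a -> add zero a = a /\ add a zero = a &
      forall a, G a -> exists b, [/\ G b, add a b = zero & add b a = zero]].

Definition archimedean (X : Type) (G : set X) (add : X -> X -> X) (zero : X)
    (lt : X -> X -> Prop) : Prop :=
  forall a b, G a -> G b -> lt zero a -> lt zero b ->
    exists n : nat, (0 < n)%N /\ lt b (iter n (add a) zero).

(* [Gamma] is totally ordered by inclusion for every invariant prime, so that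
   totality is not made part of the hypothesis. *)
Definition Gamma_archimedean_group (A : unitRingType) (P : set A)
    (R : subringClosed A) : Prop :=
  group_on (Gamma P R) (Gamma_add P R) (Gamma_zero P R) /\
  archimedean (Gamma P R) (Gamma_add P R) (Gamma_zero P R)
    (fun alpha beta => alpha `<` beta).

(* Main.v *)
Require Import Defs.
From HB Require Import structures.
From mathcomp Require Import all_boot all_order all_algebra.
From mathcomp Require Import boolp classical_sets.

Set Implicit Arguments.
Unset Strict Implicit.
Unset Printing Implicit Defensive.

Import GRing.Theory.

Local Open Scope classical_set_scope.
Local Open Scope ring_scope.

(** Every unit [u] of [A] satisfies [u \in R] or [u^-1 \in P]: [u R u^-1 = R],
    so if [u p] is not in [P] for some [p] in [P], then
    [u^-1 R (u p) = (u^-1 R u) p] lies in [P] and the prime property gives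
    [u^-1 \in P].  It remains to see that [A] is a skewfield.  If [n ^+ 2 = 0],
    the dichotomy for the unit [1 + n] yields [n \in R].  Hence a nontrivial
    idempotent [e] would put [e A (1 - e)] and [(1 - e) A e] in [R], and then
    all of [A], because [A] is simple; so [P] would be a proper ideal of [A],
    that is [P = 0].  A simple Artinian ring without nontrivial idempotents is
    a skewfield. *)

(** Otherwise choice gives [f] strictly shrinking every member of [K], and its iterates from [I0]
    form a chain that never stabilizes. *)
Lemma dcc_minimal (T : Type) (K : set (set T)) (I0 : set T) :
    (forall I : nat -> set T, (forall n, K (I n)) ->
      (forall n, I n.+1 `<=` I n) -> exists N, forall n, (N <= n)%N -> I n = I N) ->
    K I0 ->
  exists2 M, K M & forall I, K I -> I `<=` M -> I = M.
Proof.
move=> dccK KI0; apply: contrapT => noMin.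
have /choice[f fP] : forall M, exists I, K M -> [/\ K I, I `<=` M & I <> M].
  move=> M; have [KM|nKM] := pselect (K M); last by exists M.
  apply: contrapT => noI; apply: noMin; exists M => // I KI sIM.
  by apply: contrapT => neq; apply: noI; exists I.
have Kf n : K (iter n f I0) by elim: n => //= n /fP[].
have [n|N eqN] := dccK (fun n => iter n f I0) Kf.
  by case: (fP _ (Kf n)).
by have [_ _] := fP _ (Kf N); apply; apply: (eqN N.+1).
Qed.

Section SimpleArtinian.
Variable A : unitRingType.
Implicit Types L : set A.

Definition minimal_left_ideal L : Prop :=
  [/\ left_ideal L, L <> [set 0] &
      forall I, left_ideal I -> I <> [set 0] -> I `<=` L -> I = L].

Lemma artinian_minimal_left_ideal :
  artinian A -> exists L, minimal_left_ideal L.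
Proof.
move=> [dccA _].
have := @dcc_minimal _ [set I : set A | left_ideal I /\ I <> [set 0]] setT.
case=> [I KI||M [lM M0] minM].
- by apply: dccA => n; case: (KI n).
- split=> //= eqT; have : [set: A] 1 by [].
  by rewrite eqT /= => /eqP; rewrite oner_eq0.
- by exists M; split=> // I lI I0; apply: minM.
Qed.

Lemma left_idealMr L (x : A) :
  left_ideal L -> left_ideal [set y * x | y in L].
Proof.
move=> [[L0 LB] LM]; split; first split.
- by exists 0; rewrite ?mul0r.
- by move=> _ _ [y Ly <-] [z Lz <-]; exists (y - z); rewrite ?mulrBl; auto.
- by move=> r _ [y Ly <-]; exists (r * y); rewrite ?mulrA; auto.
Qed.

Lemma left_ideal_neq0 L :
  left_ideal L -> L <> [set 0] -> exists2 x, L x & x != 0.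
Proof.
move=> [[L0 _] _] Ln0; apply: contrapT => noL; apply: Ln0.
apply/seteqP; split=> [x Lx|x ->//] /=.
by apply: contrapT => /eqP x0; apply: noL; exists x.
Qed.

(** The left annihilator of [L] is a two-sided ideal. If all products in [L] vanished, it would
    contain [L], so by simplicity it would contain 1, which kills no nonzero element. *)
Lemma simple_left_ideal_sqr_neq0 L :
    simple_ring A -> left_ideal L -> L <> [set 0] ->
  exists x y, [/\ L x, L y & y * x != 0].
Proof.
move=> simpleA lL Ln0; have [x Lx x0] := left_ideal_neq0 lL Ln0.
apply: contrapT => sqr0.
have ann_id : two_sided_ideal [set a : A | forall y, L y -> a * y = 0].
  split; split.
  - split=> [y _|a b a0 b0 y Ly] /=; first by rewrite mul0r.
    by rewrite mulrBl a0 // b0 // subr0.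
  - by move=> r a a0 y Ly /=; rewrite -mulrA a0 // mulr0.
  - split=> [y _|a b a0 b0 y Ly] /=; first by rewrite mul0r.
    by rewrite mulrBl a0 // b0 // subr0.
  - by move=> r a a0 y Ly /=; rewrite -mulrA a0 //; apply: lL.2.
have [ann0|annT] := simpleA _ ann_id.
- have : [set a : A | forall y, L y -> a * y = 0] x.
    move=> y Ly; apply: contrapT => /eqP xy0.
    by apply: sqr0; exists y, x.
  by rewrite ann0 => /= /eqP; rewrite (negPf x0).
- have : [set a : A | forall y, L y -> a * y = 0] 1 by rewrite annT.
  by move=> /(_ _ Lx)/eqP; rewrite mul1r; rewrite (negPf x0).
Qed.

(** Brauer's lemma: for a suitable [x] in [L], right multiplication by [x] is a bijection of [L] by
    minimality, and the preimage [e] of [x] is idempotent. *)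
Lemma minimal_left_ideal_idempotent L :
    simple_ring A -> minimal_left_ideal L ->
  exists e, [/\ L e, e != 0 & e * e = e].
Proof.
move=> simpleA [lL Ln0 minL].
have [x [y [Lx Ly yx0]]] := simple_left_ideal_sqr_neq0 simpleA lL Ln0.
have LxE : [set z * x | z in L] = L.
  apply: minL; first exact: left_idealMr.
  - move=> Lx0; have : [set z * x | z in L] (y * x) by exists y.
    by rewrite Lx0 => /= /eqP; rewrite (negPf yx0).
  - by move=> _ [z Lz <-]; apply: lL.2.
have [e Le ex] : [set z * x | z in L] x by rewrite LxE.
have x0 : x != 0 by apply: contraNneq yx0 => ->; rewrite mulr0.
exists e; split=> //.
  by apply: contraNneq x0 => e0; rewrite -ex e0 mul0r.
have [[L0 LB] LM] := lL.
apply/eqP; rewrite -subr_eq0; apply/negPn/negP => d0.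
(* The kernel of right multiplication by [x] on [L] contains [e * e - e]; if this is nonzero,
   minimality makes the kernel all of [L], against [y * x != 0]. *)
have : L `<=` [set z | z * x = 0].
  suff <- : [set z | L z /\ z * x = 0] = L by move=> z [].
  apply: minL; [split; first split| |by move=> z []].
  - by rewrite /= mul0r.
  - by move=> a b [La a0] [Lb b0]; split; rewrite ?mulrBl ?a0 ?b0 ?subr0; auto.
  - by move=> r a [La a0]; split; rewrite -?mulrA ?a0 ?mulr0; auto.
  - move=> ker0; have : [set z | L z /\ z * x = 0] (e * e - e).
      by split; [apply: LB => //; apply: LM|rewrite mulrBl -mulrA !ex subrr].
    by rewrite ker0 => /= /eqP; rewrite (negPf d0).
by move=> /(_ _ Ly) /= /eqP; rewrite (negPf yx0).
Qed.

Lemma minimal_left_idealT_unit (a : A) :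
  minimal_left_ideal [set: A] -> a != 0 -> a \is a GRing.unit.
Proof.
move=> [lT _ minT].
have linv (b : A) : b != 0 -> exists c, c * b = 1.
  move=> b0; have bE : [set y * b | y in [set: A]] = setT.
    apply: minT => //; first exact: left_idealMr.
    move=> bE; have : [set y * b | y in [set: A]] b by exists 1; rewrite ?mul1r.
    by rewrite bE => /= /eqP; rewrite (negPf b0).
  have [c _ cb] : [set y * b | y in [set: A]] 1 by rewrite bE.
  by exists c.
(* The left inverse [b] has a left inverse [c] in turn, and [c = a], so [b] is a two-sided
   inverse. *)
move=> a0; have [b ba] := linv a a0.
have [c cb] : exists c, c * b = 1.
  apply: linv; apply: contraTneq (oner_neq0 A) => b0.
  by rewrite -ba b0 mul0r eqxx.
apply/unitrP; exists b; split=> //.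
by rewrite -[a]mul1r -cb -[c * b * a]mulrA ba mulr1.
Qed.

Lemma simple_artinian_idempotentVunit :
    simple_ring A -> artinian A ->
  (exists e : A, [/\ e * e = e, e != 0 & e != 1]) \/
  (forall a : A, a != 0 -> a \is a GRing.unit).
Proof.
move=> simpleA /artinian_minimal_left_ideal[L minL].
have [e [Le e0 ee]] := minimal_left_ideal_idempotent simpleA minL.
have [e1|e1] := eqVneq e 1; [right=> a|by left; exists e].
apply: minimal_left_idealT_unit; suff <- : L = setT by [].
apply/seteqP; split=> // x _; have [[_ LM] _ _] := minL.
by rewrite -[x]mulr1 -e1; apply: LM.
Qed.

Section SquareZero.
Variable R : subringClosed A.
Hypothesis sqr0_in : forall n : A, n * n = 0 -> n \in R.

(** The off-diagonal Peirce components square to zero, as [e] and [1 - e] annihilate each other. *)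
Let corner_in (e a : A) :
  e * e = e -> e * a * (1 - e) \in R /\ (1 - e) * a * e \in R.
Proof.
move=> ee; split; apply: sqr0_in.
- have z : (1 - e) * e = 0 by rewrite mulrBl mul1r ee subrr.
  by rewrite -!mulrA (mulrA (1 - e) e) z mul0r !mulr0.
- have z : e * (1 - e) = 0 by rewrite mulrBr mulr1 ee subrr.
  by rewrite -!mulrA (mulrA e (1 - e)) z mul0r !mulr0.
Qed.

(** The ideal [J] contains [1 - e], because [e * b * (1 - e) * c * e] is a product of two
    off-diagonal components. As [e != 1], simplicity puts 1 in [J]. *)
Let Peirce_in (e a : A) :
  simple_ring A -> e * e = e -> e != 1 -> e * a * e \in R.
Proof.
move=> simpleA ee e1; pose J := [set x | forall b c, e * b * x * c * e \in R].
have idJ : two_sided_ideal J.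
  have addJ : additive_subgroup J.
    split=> [b c|x y Jx Jy b c]; first by rewrite mulr0 !mul0r rpred0.
    by rewrite mulrBr !mulrBl rpredB.
  split; split=> // r x Jx b c; first by rewrite mulrA -(mulrA e).
  by rewrite mulrA -(mulrA _ r).
have J1e : J (1 - e).
  move=> b c; have idem : (1 - e) * (1 - e) = 1 - e.
    by rewrite mulrBr mulr1 mulrBl mul1r ee subrr subr0.
  have -> : e * b * (1 - e) * c * e = (e * b * (1 - e)) * ((1 - e) * c * e).
    by rewrite -[in LHS]idem !mulrA.
  by apply: rpredM; [case: (corner_in b ee)|case: (corner_in c ee)].
have [J0|JT] := simpleA _ idJ.
  by move: J1e; rewrite J0 /= => /eqP; rewrite subr_eq0 eq_sym (negPf e1).
have : J 1 by rewrite JT.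
by move=> /(_ a 1); rewrite !mulr1.
Qed.

Lemma sqr0_idempotent_full (e : A) :
    simple_ring A -> e * e = e -> e != 0 -> e != 1 ->
  forall a, a \in R.
Proof.
move=> simpleA ee e0 e1 a; pose f := 1 - e.
have ff : f * f = f by rewrite mulrBr mulr1 mulrBl mul1r ee subrr subr0.
have f1 : f != 1 by rewrite -subr_eq0 addrAC subrr add0r oppr_eq0.
(* Peirce decomposition; the last diagonal term is handled by the idempotent [f], which differs from
   1 since [e != 0]. *)
have -> : a = e * a * e + e * a * f + (f * a * e + f * a * f).
  by rewrite -!mulrDr addrCA subrr addr0 !mulr1 -mulrDl addrCA subrr addr0 mul1r.
have [eaf fae] := corner_in a ee.
by rewrite !rpredD // Peirce_in.
Qed.

End SquareZero.
End SimpleArtinian.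

Section InvariantPrime.
Variables (A : unitRingType) (P : set A) (R : subringClosed A).
Hypothesis primePR : invariant_prime P R.

(** [R] is the idealizer of [P], and conjugation by [u] and by [u^-1] both preserve [P]. *)
Lemma invariant_prime_inner (u r : A) :
  u \is a GRing.unit -> r \in R -> u * r * u^-1 \in R.
Proof.
move=> uU; have [_ _ RE _ invP] := primePR.
suff: subring_set R r -> subring_set R (u * r * u^-1) by [].
rewrite RE => -[rP Pr].
have invPV p : P p -> P (u^-1 * p * u).
  by rewrite -{2}[u]invrK; apply: invP; rewrite unitrV.
split=> p Pp.
- rewrite (_ : _ * p = u * (r * (u^-1 * p * u)) * u^-1).
    by apply: invP => //; apply/rP/invPV.
  by rewrite -!mulrA divrr // mulr1.
- rewrite (_ : p * _ = u * ((u^-1 * p * u) * r) * u^-1).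
    by apply: invP => //; apply/Pr/invPV.
  by rewrite -!mulrA mulVKr.
Qed.

Lemma invariant_prime_unit (u : A) :
  u \is a GRing.unit -> u \in R \/ P u^-1.
Proof.
move=> uU; have [[_ _ prime] _ RE _ invP] := primePR.
have [uP|] := pselect (forall p, P p -> P (u * p)).
  left; suff: subring_set R u by [].
  rewrite RE; split=> // p Pp.
  (* Since [p * u = u * (u^-1 * p * u)], the right-hand condition follows from the left-hand one and
     invariance. *)
  rewrite -[p * u](mulVKr uU) (mulrA u^-1); apply: uP.
  by rewrite -{2}[u]invrK; apply: invP; rewrite ?unitrV.
move=> /existsNP[p] /not_implyP[Pp nPup]; right.
have [r Rr|//|//] := prime u^-1 (u * p); rewrite mulrA.
have : subring_set R (u^-1 * r * u).
  rewrite /subring_set /= -{2}[u]invrK.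
  by apply: invariant_prime_inner; rewrite ?unitrV.
by rewrite RE => -[+ _]; apply.
Qed.

(** The inverse of [1 + n] is [1 - n], so one of the two lies in [R]. *)
Lemma invariant_prime_sqr0 (n : A) : n * n = 0 -> n \in R.
Proof.
move=> nn; have [[sPR _ _] _ _ _ _] := primePR.
have inv1 : (1 - n) * (1 + n) = 1.
  by rewrite mulrBl mul1r mulrDr mulr1 nn addr0 addrK.
have inv2 : (1 + n) * (1 - n) = 1.
  by rewrite mulrDl mul1r mulrBr mulr1 nn subr0 subrK.
have uU : 1 + n \is a GRing.unit by apply/unitrP; exists (1 - n).
have [nR|] := invariant_prime_unit uU.
  by rewrite -[n](addKr 1) addrC rpredB // rpred1.
have -> : (1 + n)^-1 = 1 - n by apply: (mulIr uU); rewrite mulVr ?inv1.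
by move=> /sPR nR; rewrite -[n](subKr 1) rpredB // rpred1.
Qed.

Lemma invariant_prime_full_eq0 :
  simple_ring A -> (forall a, a \in R) -> P = [set 0].
Proof.
move=> simpleA RT.
have [[sPR [[[[P0 PB] _] _] PT _] _] _ RE _ _] := primePR.
have idR a : idealizer P a by rewrite -RE; apply: RT.
have addP : additive_subgroup P.
  split=> // x y Px Py.
  (* [P] is an ideal only inside the type [subring R], so its elements are repackaged there. *)
  by apply: (PB (exist _ x (RT x)) (exist _ y (RT y))).
have idP : two_sided_ideal P.
  by split; split=> // r x Px; [case: (idR r) => + _|case: (idR r) => _]; apply.
have [//|PE] := simpleA P idP.
by case: PT; apply/seteqP; split=> // x _; rewrite /= PE.
Qed.

End InvariantPrime.

Theorem corollary3p5 (A : unitRingType) (P : set A) (R : subringClosed A)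
    (simpleA : simple_ring A) (artinianA : artinian A)
    (primePR : invariant_prime P R) (P_neq0 : P <> [set 0])
    (archGamma : Gamma_archimedean_group P R) :
  valuation_ring R.
Proof.
have [[e [ee e0 e1]]|unitA] := simple_artinian_idempotentVunit simpleA artinianA.
  case: P_neq0; apply: (invariant_prime_full_eq0 primePR simpleA).
  apply: sqr0_idempotent_full simpleA ee e0 e1.
  exact: (invariant_prime_sqr0 primePR).
split=> // [u x uU|a /unitA aU]; first exact: (invariant_prime_inner primePR).
have [[sPR _ _] _ _ _ _] := primePR.
by have [|/sPR] := invariant_prime_unit primePR aU; [left|right].
Qed.
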